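(* Let $\Gamma\cong L\oplus H$ be a finite Abelian group with $\Gamma\in\mathcal{G}$, where $|H|$ is odd and $|L|=2^{\eta}$ for some natural number $\eta$. Let $l=2\exp(L)$ if $\exp(\Gamma)=|\Gamma|/2$, and $l=\exp(L)$ otherwise. Let $k>1$ be a divisor of $|H|$ and let $m=kl$. Then there exist a complete mapping $\varphi$ of $\Gamma$ and a partition $S_1,S_2,\ldots,S_t$ of the elements of $\Gamma$ such that $|S_i|=m$ and $\sum_{s\in S_i}s=\sum_{s\in S_i}\varphi(s)=0$ for every $1\leq i\leq t$.
   Context: Groups are finite Abelian, written additively, with identity element $0$. $\exp(\cdot)$ of a group is the least common multiple of the orders of all its elements. An involution is an element of order $2$. $\mathcal{G}$ denotes the set of all Abelian groups that are of odd order or contain more than one involution. A complete mapping of $\Gamma$ is a bijection $\varphi\colon\Gamma\to\Gamma$ such that the mapping $g\mapsto g+\varphi(g)$ is also a bijection of $\Gamma$. *)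

(* Defs.v *)
From HB Require Import structures.
From mathcomp Require Import all_boot all_order all_algebra all_fingroup all_solvable.

Set Implicit Arguments.
Unset Strict Implicit.
Unset Printing Implicit Defensive.

Import GRing.Theory.
Local Open Scope ring_scope.

Definition zmod_isomorphic (A B : zmodType) : Prop :=
  exists f : {additive A -> B}, bijective f.

(* A finZmodType carries a canonical finGroupType structure whose law is
   addition, so #[x]%g and [exponent] below are the additive order and
   exponent. *)
Definition involutions (G : finZmodType) : {set G} := [set x : G | #[x]%g == 2%N].

Definition class_G (G : finZmodType) : bool :=
  odd #|G| || (1 < #|involutions G|)%N.

Definition zexp (G : finZmodType) : nat := exponent [set: G].

Definition complete_mapping (G : zmodType) (phi : G -> G) : Prop :=
  bijective phi /\ bijective (fun g : G => g + phi g).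

(* The condition exp(Gamma) = |Gamma| / 2 is an equality of rationals, hence
   it is written without truncated division: for |Gamma| odd it is false. *)
Definition block_factor (Gamma L : finZmodType) : nat :=
  if (2 * zexp Gamma == #|Gamma|)%N then (2 * zexp L)%N else zexp L.

(* Main.v *)
Require Import Defs.
From HB Require Import structures.
From mathcomp Require Import all_boot all_order all_algebra all_fingroup all_solvable.
From mathcomp Require Import finfield.

(** Identify Gamma with L x H.  The hypothesis on involutions says that L is
    trivial or a noncyclic 2-group, since an element of order 2 has trivial
    component in H and a cyclic group has at most one involution.

    Every map used here is fibrewise: (a, h) is sent to (phi_q a, h), where
    phi_q is a complete mapping of L that depends only on a label q < k of h.
    It is complete because h |-> h + h is a bijection of the odd group H.

    The labels come from H alone ([zero_sum_blocks]).  Take a subgroup K of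
    index k.  There is a transversal of K with sum zero, and shifting its
    members by i, i, -2i, i, -i, i, -i, .. for i in K gives, as i varies, a
    partition of H into transversals of sum zero; here k >= 3 is odd, and
    doubling is injective on K.  A block of Gamma is then obtained from one such
    transversal {b_q} by choosing over each b_q an l-subset of L.  If the l-sets
    over b_q are the fibres of a colouring c_q of L, and one colour is used for
    all q, the H-component of the block sum is l times zero, and what is left is
    a condition on L only: over all q < k, the fibres of c_q of a given colour
    must have total sum zero, and so must their images under phi_q.  Such data
    form a [balanced_family]; [zero_sum_assembly] turns them into the result.

    Pairs of labels can be cancelled by using (phi, c) for one and the data
    conjugated by a |-> -a for the other.  So [balanced_family_odd] reduces all
    odd k to k = 3.

    When l = |L| the only fibre is L, and any complete mapping f suffices:
    summing x + f x = y over the whole group gives twice the sum of L on one side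
    and the sum of L on the other, hence the sum is zero.  Otherwise
    l = exp(L), and for noncyclic L there are three cases
    ([balanced_family_two_group]).
    - If l = 2, L is the additive group of a field with at least four elements,
      and multiplication by w with w <> 0, -1 is an additive complete mapping.
      Use the pairs {a, a + d_q} with d_0 + d_1 + d_2 = 0.
    - If 4 divides l and |L| >= 4l, some noncyclic subgroup A of order l has a
      noncyclic quotient.  Complete mappings of A and of L / A combine into one
      of L that permutes the cosets of A, and each coset has sum zero.
    - If 4 divides l and |L| = 2l, no such A exists.  Take instead three
      subgroups of index 2 whose characters to Z/2 add up to zero, and an explicit
      complete mapping of a group with a cyclic subgroup of index 2.
    The same three constructions prove by induction that every noncyclic abelian
    2-group has a complete mapping ([complete_noncyclic]), the case of the
    Hall-Paige theorem that is needed. *)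

Set Implicit Arguments.
Unset Strict Implicit.
Unset Printing Implicit Defensive.

Import GRing.Theory.
Local Open Scope ring_scope.

(** * Complete mappings of noncyclic abelian 2-groups *)

Section CompleteOnGroups.

Local Open Scope group_scope.

(** Stated for subsets of a multiplicative finite group because the quotients
    in the induction are of type [coset_of A], which carries no additive
    structure.  On a finite additive group the two laws are convertible. *)
Definition complete_on (gT : finGroupType) (G : {set gT}) (f : gT -> gT) : Prop :=
  [/\ {in G, forall x, f x \in G}, {in G &, injective f}
    & {in G &, injective (fun x => x * f x)}].

(** In coset representatives, send r c * t with t in A to r (b c) * a t.  The
    image determines c through b and then t through a; the product
    r c * r (b c) * (t * a t) determines them in the same order. *)
Lemma complete_extension (gT : finGroupType) (G A : {group gT})
    (a : gT -> gT) (b : coset_of A -> coset_of A) :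
    A \subset G -> abelian G -> complete_on A a -> complete_on (G / A) b ->
  exists2 f : gT -> gT, complete_on G f
    & {in G, forall x, coset A (f x) = b (coset A x)}.
Proof.
move=> sAG abG [aA a_inj a_inj'] [bQ b_inj b_inj'].
have nAG : G \subset 'N(A) := sub_abelian_norm abG sAG.
pose r (c : coset_of A) := repr c.
have rP c : c \in G / A -> r c \in G /\ coset A (r c) = c.
  move=> cQ; split; last exact: coset_reprK.
  case/morphimP: cQ => x nx Gx ->; rewrite /r /= val_coset //.
  by case: repr_rcosetP => y /(subsetP sAG) Gy; rewrite groupM.
have inQ x : x \in G -> coset A x \in G / A by exact: mem_quotient.
have rest x : x \in G -> (r (coset A x))^-1 * x \in A.
  move=> Gx; have [Gr rK] := rP _ (inQ x Gx).
  have nr := subsetP nAG _ Gr; have nx := subsetP nAG _ Gx.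
  apply: coset_idr; first by rewrite groupM ?groupV.
  by rewrite morphM ?groupV // morphV //= rK mulVg.
(* r (coset A x)^-1 * x is the component of x in A. *)
pose f x := r (b (coset A x)) * a ((r (coset A x))^-1 * x).
have fG x : x \in G -> f x \in G.
  move=> Gx; rewrite groupM //; first by case: (rP _ (bQ _ (inQ x Gx))).
  by rewrite (subsetP sAG) ?aA ?rest.
have cf x : x \in G -> coset A (f x) = b (coset A x).
  move=> Gx; have [Gr rK] := rP _ (bQ _ (inQ x Gx)).
  by rewrite coset_kerr ?aA ?rest.
exists f => //; split=> // x y Gx Gy eq_xy.
  have eqc : coset A x = coset A y.
    by apply: b_inj; rewrite ?inQ // -!cf // eq_xy.
  have := rest x Gx; move: eq_xy; rewrite /f eqc => /mulgI eq_a Ax.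
  exact/(mulgI (r (coset A y))^-1)/a_inj/eq_a/rest.
have eqc : coset A x = coset A y.
  apply: b_inj'; rewrite ?inQ // -!cf // -!morphM ?(subsetP nAG) ?fG //.
  by rewrite eq_xy.
have [Gr rK] := rP _ (inQ x Gx); have [Gb bK] := rP _ (bQ _ (inQ x Gx)).
have split_f z : z \in G -> coset A z = coset A x ->
    z * f z = r (coset A x) * r (b (coset A x))
              * ((r (coset A x))^-1 * z * a ((r (coset A x))^-1 * z)).
  move=> Gz eqz; have := rest z Gz; rewrite /f eqz => Az.
  rewrite -{1}(mulKVg (r (coset A x)) z).
  move: (_^-1 * z) Az => t At; rewrite -!mulgA; congr (_ * _).
  rewrite !mulgA; congr (_ * _).
  by apply: (centsP abG) => //; exact: (subsetP sAG).
move: eq_xy; rewrite split_f // split_f // => /mulgI eq_a.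
apply/(mulgI (r (coset A x))^-1)/a_inj'/eq_a; first exact: rest.
by rewrite eqc rest.
Qed.

(** Such a group is the additive group of a field of order at least 4, so it has
    an element w other than 0 and -1; multiplication by w and by 1 + w is
    bijective. *)
Lemma complete_abelem2 (gT : finGroupType) (G : {group gT}) :
    2.-abelem G -> ~~ cyclic G ->
  exists2 f : gT -> gT, complete_on G f & {in G &, {morph f : x y / x * y}}.
Proof.
move=> abelG ncG.
have pG := abelem_pgroup abelG.
have [n oG] := p_natP pG.
have n_gt1 : (1 < n)%N.
  case: n oG => [|[|n]] // oG; case/negP: ncG.
    by rewrite (card1_trivg oG) cyclic1.
  by rewrite prime_cyclic // oG.
have [F char2 oF] := @pPrimePowerField 2 n isT (ltnW n_gt1).
have isoGF : G \isog [set: F].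
  by rewrite (isog_abelem_card _ abelG) fin_ring_pchar_abelem //= cardsT oF oG eqxx.
have [h h_inj hF] := isogP isoGF.
have [w w0 w1] : exists2 w : F, w != 0%R & w != (- 1)%R.
  have : ~~ ([set: F] \subset [set 0%R; (- 1)%R]).
    apply/negP => /subset_leq_card; rewrite cardsT oF.
    move/(leq_trans (leq_pexp2l (isT : (0 < 2)%N) n_gt1)).
    by rewrite cards2; case: eqP.
  case/subsetPn => w _; rewrite !inE negb_or => /andP[]; by exists w.
pose g := invm h_inj.
pose f x := g (w * h x)%R.
have gK y : h (g y) = y by rewrite /g invmK // hF inE.
have hK : {in G, cancel h g} by move=> x; exact: invmE.
have gG y : g y \in G.
  have: y \in h @* G by rewrite hF inE.
  by case/morphimP=> x _ Gx ->; rewrite hK.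
have h_injG : {in G &, injective h} by exact/injmP.
have mulF (y z : F) : y * z = (y + z)%R by [].
exists f; last first.
  move=> x y Gx Gy; apply: h_injG; rewrite ?groupM ?gG //.
  by rewrite morphM ?gG // !gK mulF -mulrDr; congr (_ * _)%R; rewrite morphM.
split=> [x Gx | x y Gx Gy /(congr1 h) | x y Gx Gy /(congr1 h)]; first exact: gG.
  by rewrite !gK => /(mulfI w0)/h_injG; exact.
rewrite !morphM ?gG // !gK !mulF -[X in (X + _)%R = _]mul1r -[X in _ = (X + _)%R]mul1r.
rewrite -!mulrDl => /mulfI; rewrite addrC addr_eq0 => /(_ w1) /h_injG; exact.
Qed.

Lemma mem_index2 (gT : finGroupType) (G B : {group gT}) (s t : gT) :
    B \subset G -> #|G| = (2 * #|B|)%N -> s \in G -> t \in G -> t \notin B ->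
  (t * s \in B) = (s \notin B).
Proof.
move=> sBG oG Gs Gt nBt; have [Bs | nBs] := boolP (s \in B).
  by rewrite groupMr // (negPf nBt).
have /eqP eqG : B :|: t^-1 *: B == G.
  have sCG : t^-1 *: B \subset G.
    by rewrite -(lcoset_id (groupVr Gt)); exact: mulgS.
  rewrite eqEcard subUset sBG sCG /=.
  rewrite cardsU card_lcoset oG mulSn mul1n.
  suff -> : B :&: (t^-1 *: B) = set0 by rewrite cards0 subn0.
  apply/setP=> y; rewrite !inE mem_lcoset invgK; apply/negP=> /andP[By].
  by rewrite groupMr // (negPf nBt).
by move: Gs; rewrite -{1}eqG inE (negPf nBs) /= mem_lcoset invgK => ->.
Qed.

(** Write X = <[x]> and let h be its involution.  Halving in X has two ambiguities:
    an element of X is a square b^2 or x * b^2, and then b is known up to h.  An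
    element of G is u^e * b with b in X; put s = x^e * b and send it to
    u^(e + T s) * s, where T : X -> bool takes opposite values on b and b * h.
    The image gives s, hence T s, e and b.  The product of the element and its
    image is u^(T s) * x^e * b^2: the factor in X gives e and then b up to h, and
    T s decides between b and b * h.  On X the map multiplies by 1 or u, hence
    preserves squares, which is used in [balanced_family_index2]. *)
Lemma complete_cyclic_index2 (gT : finGroupType) (G : {group gT}) (x u : gT) :
    abelian G -> x \in G -> u \in G -> ~~ odd #[x] ->
    u * u = 1 -> u \notin <[x]> -> #|G| = (2 * #[x])%N ->
  exists2 f : gT -> gT, complete_on G f
    & {in <[x]>, forall a, f a * f a = a * a}.
Proof.
move=> abG Gx Gu x_even u2 nXu oG; pose X := <[x]>%G.
have sXG : X \subset G by rewrite cycle_subG.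
have mulC : {in G &, commutative (@mulg gT)} by move=> y z Gy Gz; exact: (centsP abG).
have GX y : y \in X -> y \in G by exact: (subsetP sXG).
pose M := #[x]./2; pose h := x ^+ M.
have oxM : #[x] = (M * 2)%N by rewrite muln2 /M halfK (negPf x_even) subn0.
have M_gt0 : (0 < M)%N by have := order_gt0 x; rewrite oxM; case: (M).
have oh : #[h] = 2%N.
  by rewrite /h orderXdiv oxM ?dvdn_mulr // mulKn.
have Xh : h \in X by rewrite mem_cycle.
have sqX b b' : b \in X -> b' \in X -> b * b = b' * b' -> b' = b \/ b' = b * h.
  move=> Xb Xb' eq_bb; set t := b^-1 * b'.
  have Xt : t \in X by rewrite groupM ?groupV.
  have t2 : t ^+ 2 = 1.
    rewrite expgMn; last by apply: mulC; rewrite ?groupV GX.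
    by rewrite !expgS !expg0 !mulg1 -eq_bb -invMg mulVg.
  have -> : b' = b * t by rewrite mulKVg.
  have [-> | t1] := eqVneq t 1; first by left; rewrite mulg1.
  have ot : #[t] = 2%N by exact: nt_prime_order.
  have /eqP : <[t]>%G :==: <[h]>%G.
    by rewrite (eq_subG_cyclic (cycle_cyclic x)) ?cycle_subG //= -!orderE ot oh.
  move=> /= eq_th; have := cycle_id t; rewrite eq_th cycle2g // !inE (negPf t1).
  by move=> /eqP->; right.
have xnsq b b' : b \in X -> b' \in X -> x * (b * b) <> b' * b'.
  case/cycleP=> i -> /cycleP[j ->] /eqP; rewrite -!expgD -expgS.
  rewrite eq_expg_mod_order oxM => /eqP/(congr1 odd).
  by rewrite !odd_mod ?oddM ?andbF //= !oddD !addbb.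
(* T singles out one element of each coset of <[h]>. *)
pose T b := repr (<[h]> :* b) == b.
have TX b : b \in X -> T (b * h) = ~~ T b.
  move=> Xb; rewrite /T (mulC b h) ?GX //.
  rewrite rcosetM rcoset_id ?cycle_id //.
  have : repr (<[h]> :* b) \in [:: b; h * b].
    have := mem_repr_rcoset <[h]>%G b; rewrite /= mem_rcoset cycle2g // !inE.
    by rewrite -(inj_eq (mulIg b)) mulgKV mul1g -[_ == h](inj_eq (mulIg b)) mulgKV.
  have nbh : (b == h * b) = false.
    rewrite -{1}[b]mul1g (inj_eq (mulIg b)); apply/eqP=> h1.
    by move: oh; rewrite -h1 order1.
  by rewrite !inE => /orP[]/eqP->; rewrite eqxx ?nbh // eq_sym nbh.
have uX (e e' : bool) b b' : b \in X -> b' \in X -> u ^+ e * b = u ^+ e' * b' ->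
    e = e' /\ b = b'.
  have nuX y y' : y \in X -> y' \in X -> y <> u * y'.
    by move=> Xy Xy' eqy; case/negP: nXu; rewrite -(groupMr _ Xy') -eqy.
  move=> Xb Xb'; case: e e' => -[]; rewrite ?expg0 ?expg1 ?mul1g //.
  - by move/mulgI.
  - by move/esym/nuX; case.
  - by move/nuX; case.
(* d a is the factor b in a = u^e * b with e = (a \notin X). *)
pose d a := if a \in X then a else u * a.
have dX a : a \in G -> d a \in X.
  rewrite /d => Ga; case: ifPn => // nXa.
  by rewrite (@mem_index2 _ G X).
have dE a : a = u ^+ (a \notin X) * d a.
  rewrite /d; case: ifP => _; first by rewrite mul1g.
  by rewrite expg1 mulgA u2 mul1g.
pose s a := x ^+ (a \notin X) * d a.
have sX a : a \in G -> s a \in X by move=> Ga; rewrite groupM ?mem_cycle ?dX.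
pose f a := u ^+ ((a \notin X) (+) T (s a)) * s a.
have fE a : a \in G -> a * f a = u ^+ T (s a) * (x ^+ (a \notin X) * (d a * d a)).
  move=> Ga; rewrite /f {1}[a]dE mulgA -(mulgA _ (d a)).
  rewrite (mulC (d a)) ?(groupX _ Gu) ?GX ?dX //.
  rewrite -!mulgA mulgA -expgD.
  have -> : u ^+ ((a \notin X) + ((a \notin X) (+) T (s a))) = u ^+ T (s a).
    by case: (a \notin X); case: (T _); rewrite //= expgS expg1 u2.
  by congr (_ * _); rewrite mulC ?GX ?dX ?sX // /s mulgA.
exists f; last first.
  move=> a Xa; have Ga := GX a Xa.
  have sa : s a = a by rewrite /s /d Xa mul1g.
  rewrite /f Xa sa -!mulgA (mulgA a) (mulC a) ?groupX // mulgA mulgA -mulgA -expgD.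
  by case: (T a); rewrite /= ?mul1g // expgS expg1 u2 mul1g.
split=> [a Ga | a b Ga Gb | a b Ga Gb].
- by rewrite groupM ?(groupX _ Gu) ?GX ?sX.
- move=> eqf; have [eqT eqs] := uX _ _ _ _ (sX a Ga) (sX b Gb) eqf.
  move: eqT; rewrite eqs => /addIb eqX.
  move: eqs; rewrite /s eqX => /mulgI eqd.
  by rewrite [a]dE [b]dE eqX eqd.
have sdX y : y \in G -> x ^+ (y \notin X) * (d y * d y) \in X.
  by move=> Gy; rewrite !groupM ?dX ?mem_cycle.
rewrite !fE // => eqf; have [eqT eqx] := uX _ _ _ _ (sdX a Ga) (sdX b Gb) eqf.
have eqX : (a \notin X) = (b \notin X).
  move: eqx; case: (a \notin X); case: (b \notin X) => //=.
    by rewrite expg1 mul1g => /(xnsq _ _ (dX a Ga) (dX b Gb)).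
  by rewrite expg1 mul1g => /esym/(xnsq _ _ (dX b Gb) (dX a Ga)).
move: eqx; rewrite eqX => /mulgI/(sqX _ _ (dX a Ga) (dX b Gb))[] eqd.
  by rewrite [a]dE [b]dE eqX eqd.
move: eqT; rewrite /s eqX eqd mulgA TX; last by rewrite -eqX -/(s a) sX.
by case: (T _).
Qed.

(** A cyclic subgroup of maximal order has a complement; it is nontrivial, so it
    contains an involution. *)
Lemma noncyclic_involution (gT : finGroupType) (G : {group gT}) (x : gT) :
    abelian G -> 2.-group G -> ~~ cyclic G -> x \in G -> #[x] = exponent G ->
  exists u, [/\ u \in G, #[u] = 2%N & u \notin <[x]>].
Proof.
move=> abG pG ncG Gx ox.
have [K /complP[tiXK defG]] := splitsP (abelian_splits Gx ox abG).
have sKG : K \subset G by rewrite -defG mulG_subr.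
have ntK : K :!=: 1.
  apply: contra ncG => /eqP K1; rewrite -defG K1 mulg1; exact: cycle_cyclic.
have [_ dvd2 _] := pgroup_pdiv (pgroupS sKG pG) ntK.
have [u Ku ou] := Cauchy (isT : prime 2) dvd2; exists u; split=> //.
  exact: subsetP sKG u Ku.
apply/negP=> Xu; have : u \in <[x]> :&: K by rewrite inE Xu.
by rewrite tiXK => /set1P u1; move: ou; rewrite u1 order1.
Qed.

(** Take x of maximal order e, an involution u outside <[x]>, and
    A = <[u]> x <[x ^+ 2]>.  Every element of A is killed by e / 2 < |A|, so A is
    not cyclic.  If a coset of y generated G / A, then x, whose square is in A,
    would be congruent mod A to an even power of y, because 4 divides |G / A|;
    then x ^+ (e / 2) = 1, a contradiction. *)
Lemma noncyclic_subgroup (gT : finGroupType) (G : {group gT}) :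
    abelian G -> 2.-group G -> ~~ cyclic G -> (4 %| exponent G)%N ->
  exists A : {group gT},
    [/\ A \subset G, #|A| = exponent G, ~~ cyclic A
      & (4 * exponent G <= #|G|)%N -> ~~ cyclic (G / A)].
Proof.
move=> abG pG ncG e4.
have [x Gx ox] := exponent_witness (abelian_nil abG).
have [u [Gu ou nXu]] := noncyclic_involution abG pG ncG Gx (esym ox).
case/dvdnP: e4 => r er; pose M := (r * 2)%N.
have eM : exponent G = (M * 2)%N by rewrite er -mulnA.
have M_gt0 : (0 < M)%N by have := exponent_gt0 G; rewrite eM; case: (M).
have oxM : #[x] = (M * 2)%N by rewrite -ox.
pose A := (<[u]> <*> <[x ^+ 2]>)%G; exists A.
have sUG : <[u]> \subset G by rewrite cycle_subG.
have sX2G : <[x ^+ 2]> \subset G by rewrite cycle_subG groupX.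
have defA : A :=: <[u]> * <[x ^+ 2]>.
  by apply: cent_joinEr; exact: sub_abelian_cent2 abG sX2G sUG.
have sAG : A \subset G by rewrite defA mul_subG.
have oA : #|A| = exponent G.
  rewrite /= defA TI_cardMg.
    by rewrite -!orderE ou orderXdiv oxM ?dvdn_mull // mulnK // eM mulnC.
  apply: prime_TIg; first by rewrite -orderE ou.
  apply: contra nXu; rewrite cycle_subG => Xu.
  by apply: subsetP Xu; rewrite cycle_subG mem_cycle.
have AM y : y \in A -> y ^+ M = 1.
  rewrite defA => /imset2P[_ _ /cycleP[i ->] /cycleP[j ->] ->].
  rewrite expgMn; last first.
    by apply: (centsP abG); rewrite ?groupX.
  rewrite -!expgM.
  have /eqP-> : u ^+ (i * M) == 1 by rewrite -order_dvdn ou mulnA dvdn_mull.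
  have /eqP-> : x ^+ (2 * (j * M)) == 1.
    by rewrite -order_dvdn oxM mulnCA [(M * 2)%N]mulnC dvdn_mull.
  exact: mulg1.
split=> // [|leG].
  apply/negP=> /exponent_cyclic; rewrite oA eM => eA.
  have : (exponent A %| M)%N by apply/exponentP.
  by rewrite eA => /(dvdn_leq M_gt0); rewrite leqNgt ltn_Pmulr.
have nAG : G \subset 'N(A) := sub_abelian_norm abG sAG.
apply/negP => /cyclicP[c defQ].
have oc : (4 %| #[c])%N.
  have pQ : 2.-group (G / A) by exact: quotient_pgroup.
  have [n oQ] := p_natP pQ.
  have : (4 <= #|G / A|)%N.
    by rewrite card_quotient // -divgS // oA leq_divRL ?exponent_gt0.
  rewrite orderE -defQ oQ; case: n {oQ} => [|[|n]] // _.
  by rewrite !expnS mulnA dvdn_mulr.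
have Qc : c \in G / A by rewrite defQ cycle_id.
case/morphimP: Qc => y ny Gy cy.
have nx := subsetP nAG _ Gx.
have : coset A x \in <[c]> by rewrite -defQ mem_quotient.
case/cycleP => i xi.
have even_i : (2 %| i)%N.
  have : c ^+ (i * 2) == 1.
    rewrite expgM -xi -morphX //= coset_id // defA.
    by apply/imset2P; exists 1 (x ^+ 2); rewrite ?group1 ?cycle_id ?mul1g.
  rewrite -order_dvdn => /(dvdn_trans oc); rewrite (_ : 4 = 2 * 2)%N //.
  by rewrite dvdn_pmul2r.
case/dvdnP: even_i => j ij.
have : x * (y ^+ i)^-1 \in A.
  apply: coset_idr; first by rewrite groupM ?groupV ?groupX.
  by rewrite morphM ?groupV ?groupX // morphV ?groupX //= morphX //= -cy -xi mulgV.
move/AM; rewrite expgMn; last first.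
  by apply: (centsP abG); rewrite ?groupV ?groupX.
rewrite expgVn -expgM ij -mulnA (mulnC 2) -eM mulnC expgM.
rewrite expg_exponent // expg1n invg1 mulg1 => /eqP.
rewrite -order_dvdn oxM => /(dvdn_leq M_gt0).
by rewrite leqNgt ltn_Pmulr.
Qed.

Lemma dvdn_exponent_noncyclic (gT : finGroupType) (G : {group gT}) :
    abelian G -> 2.-group G -> ~~ cyclic G -> (2 * exponent G %| #|G|)%N.
Proof.
move=> abG pG ncG.
have [e oe] := p_natP (pnat_dvd (exponent_dvdn G) pG).
have [m oG] := p_natP pG.
have [x Gx ox] := exponent_witness (abelian_nil abG).
have : (exponent G < #|G|)%N.
  rewrite ox orderE proper_card // properEneq cycle_subG Gx andbT.
  by apply: contra ncG => /eqP <-; exact: cycle_cyclic.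
by rewrite oe oG -expnS ltn_exp2l // => lt_em; exact: dvdn_exp2l.
Qed.

(** This isolates the groups on which [noncyclic_subgroup] gives a quotient of
    order 2, which has no complete mapping. *)
Lemma card_noncyclic_small (gT : finGroupType) (G : {group gT}) :
    abelian G -> 2.-group G -> ~~ cyclic G -> (#|G| < 4 * exponent G)%N ->
  #|G| = (2 * exponent G)%N.
Proof.
move=> abG pG ncG; case/dvdnP: (dvdn_exponent_noncyclic abG pG ncG) => r oG.
have := cardG_gt0 G; rewrite oG mulnA ltn_pmul2r ?exponent_gt0 //.
by case: r {oG} => [|[|r]] // _; rewrite ltnNge leq_pmul2r.
Qed.

Lemma complete_noncyclic (gT : finGroupType) (G : {group gT}) :
    abelian G -> 2.-group G -> ~~ cyclic G -> exists f, complete_on G f.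
Proof.
have [n] := ubnP #|G|; elim: n => // n IHn in gT G *.
rewrite ltnS => leGn abG pG ncG.
have [e oe] := p_natP (pnat_dvd (exponent_dvdn G) pG).
have [x Gx ox] := exponent_witness (abelian_nil abG).
have [u [Gu ou nXu]] := noncyclic_involution abG pG ncG Gx (esym ox).
have [e4 | ne4] := boolP (4 %| exponent G)%N; last first.
  have abelG : 2.-abelem G.
    rewrite abelemE // abG oe; case: e oe ne4 => [|[|e]] // ->.
    by rewrite !expnS mulnA dvdn_mulr.
  by have [f] := complete_abelem2 abelG ncG; exists f.
have [A [sAG oA ncA ncQ]] := noncyclic_subgroup abG pG ncG e4.
have [le4 | gt4] := leqP (4 * exponent G) #|G|.
  have ltAG : (#|A| < #|G|)%N.
    by rewrite oA (leq_trans _ le4) // ltn_Pmull ?exponent_gt0.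
  have [a aP] : exists a, complete_on A a.
    apply: IHn; rewrite ?(abelianS sAG) ?(pgroupS sAG) //.
    exact: leq_trans ltAG leGn.
  have [b bP] : exists b, complete_on (G / A) b.
    apply: IHn; rewrite ?quotient_abelian ?quotient_pgroup ?ncQ //.
    rewrite (leq_trans _ leGn) // ltn_quotient //.
    by apply: contra ncA => /eqP->; exact: cyclic1.
  by have [f] := complete_extension sAG abG aP bP; exists f.
have oG : #|G| = (2 * #[x])%N by rewrite (card_noncyclic_small abG) ?ox // -ox.
have x_even : ~~ odd #[x] by rewrite -ox -dvdn2 (dvdn_trans _ e4).
have u2 : u * u = 1 by rewrite -[RHS](expg_order u) ou.
by have [f] := complete_cyclic_index2 abG Gx Gu x_even u2 nXu oG; exists f.
Qed.

End CompleteOnGroups.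

(** * Sums in finite additive groups *)

Lemma sum_odd_pairs (V : zmodType) (F : nat -> V) (k : nat) :
    odd k -> (1 < k)%N -> F 0 + F 1 + F 2 = 0 ->
    (forall q, (2 < q)%N -> odd q -> F q + F q.+1 = 0) ->
  \sum_(q < k) F q = 0.
Proof.
move=> odd_k k_gt1 F3 Fpair.
have [r ->] : exists r, k = (r.*2 + 3)%N.
  exists (k - 3)./2; have := odd_double_half (k - 3).
  have k3 : (3 <= k)%N by case: k odd_k k_gt1 => [|[|[|]]].
  by rewrite oddB // odd_k /= add0n => ->; rewrite subnK.
elim: r => [|r IHr]; first by rewrite !big_ord_recr big_ord0 /= add0r.
rewrite doubleS !addSn !big_ord_recr IHr /= add0r Fpair ?addn3 //=.
by rewrite odd_double.
Qed.

Lemma sum_perm_in (V : finZmodType) (A : {set V}) (f : V -> V) :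
    {in A, forall x, f x \in A} -> {in A &, injective f} ->
  \sum_(x in A) f x = \sum_(x in A) x.
Proof.
move=> fA f_inj; rewrite -(big_imset id f_inj) /=.
suff -> : [set f x | x in A] = A by [].
apply/eqP; rewrite eqEcard card_in_imset // leqnn andbT.
by apply/subsetP=> _ /imsetP[x Ax ->]; exact: fA.
Qed.

(** With s the sum of A, summing x + f x over A gives s + s = s. *)
Lemma sum_complete_on (V : finZmodType) (A : {group V}) (f : V -> V) :
  complete_on A f -> \sum_(x in A) x = 0.
Proof.
move=> [fA f_inj sf_inj].
have sfA : {in A, forall x, x + f x \in A}.
  by move=> x Ax; rewrite -[x + f x]/(x * f x)%g groupM // fA.
have /eqP := sum_perm_in sfA sf_inj.
by rewrite big_split /= (sum_perm_in fA) // -subr_eq0 addrK => /eqP.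
Qed.

Lemma complete_onT (V : finZmodType) (f : V -> V) :
  complete_on [set: V] f -> complete_mapping f.
Proof.
move=> [_ f_inj sf_inj]; split; apply: injF_bij.
  by move=> x y; apply: f_inj; rewrite inE.
by move=> x y; apply: sf_inj; rewrite inE.
Qed.

(** * Balanced families on the 2-part *)

Section BalancedFamilies.

Variable V : finZmodType.

(** The sequences are indexed by nat, although only q < k matters, so that
    families of different lengths have the same type. *)
Definition balanced_family (J : finType) (l k : nat)
    (phi : nat -> V -> V) (c : nat -> V -> J) : Prop :=
  [/\ forall q, complete_mapping (phi q),
      forall q j, #|[set a | c q a == j]| = l,
      forall j, \sum_(q < k) \sum_(a | c q a == j) a = 0
    & forall j, \sum_(q < k) \sum_(a | c q a == j) phi q a = 0].

(** The labels q >= 3 are grouped in pairs, an odd q carrying (phi 0, c 0) and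
    q + 1 its conjugate by a |-> -a, whose fibre sums are the opposite ones. *)
Lemma balanced_family_odd (J : finType) (l k : nat)
    (phi : nat -> V -> V) (c : nat -> V -> J) :
    odd k -> (1 < k)%N -> balanced_family l 3 phi c ->
  exists phi' c', @balanced_family J l k phi' c'.
Proof.
move=> odd_k k_gt1 [phiP cP sumc sumphi].
pose extend (T : Type) (f g : nat -> T) (f' : T) q : T :=
  if (q < 3)%N then f q else if odd q then g 0 else f'.
pose phi' := extend _ phi phi (fun a => - phi 0 (- a)).
pose c' := extend _ c c (fun a => c 0 (- a)).
have sumN (F : V -> V) j :
    \sum_(a | c 0 (- a) == j) F (- a) = \sum_(a | c 0 a == j) F a.
  by rewrite [RHS](reindex_inj (@oppr_inj V)).
have gt2 q : (2 < q)%N -> (q < 3)%N = false /\ (q.+1 < 3)%N = false.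
  by case: q => [|[|[|q]]].
exists phi', c'; split.
- move=> q; rewrite /phi' /extend; do 2!case: ifP => _ //.
  have [[g gK Kg] [h hK Kh]] := phiP 0.
  split; [exists (fun a => - g (- a)) | exists (fun a => - h (- a))] => a.
  + by rewrite opprK gK opprK.
  + by rewrite opprK Kg opprK.
  + by rewrite opprB addrC hK opprK.
  + by rewrite opprK -opprD Kh opprK.
- move=> q j; rewrite /c' /extend; do 2!case: ifP => _ //.
  rewrite -(cP 0 j) -(card_imset _ (@oppr_inj V)); apply: eq_card => a.
  apply/imsetP/idP => [[b] | ]; rewrite !inE => cb.
    by move=> ->.
  by exists (- a); rewrite ?inE !opprK.
- move=> j; apply: (@sum_odd_pairs _ (fun q => \sum_(a | c' q a == j) a)) => //.
    by have := sumc j; rewrite !big_ord_recr big_ord0 /= add0r.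
  move=> q q_gt2 odd_q; have [q3 q13] := gt2 q q_gt2.
  rewrite /c' /extend q3 q13 /= odd_q /=.
  by rewrite -(sumN id) /= -big_split big1 // => a _; rewrite /= addNr.
- move=> j; apply: (@sum_odd_pairs _ (fun q => \sum_(a | c' q a == j) phi' q a)) => //.
    by have := sumphi j; rewrite !big_ord_recr big_ord0 /= add0r.
  move=> q q_gt2 odd_q; have [q3 q13] := gt2 q q_gt2.
  rewrite /phi' /c' /extend q3 q13 /= odd_q /=.
  by rewrite -(sumN (phi 0)) /= -big_split big1 // => a _; rewrite /= addrN.
Qed.

Lemma coset_coloring (B : {group V}) (n : nat) : #|V| = (n * #|B|)%N ->
  exists c : V -> 'I_n, forall j, exists y, forall a, (c a == j) = (a - y \in B).
Proof.
move=> oV; pose P := rcosets B [set: V].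
have oP : #|P| = n.
  rewrite /P -[#|_|]/(#|[set: V] : B|)%g -divgS ?subsetT //.
  by rewrite cardsT oV mulnK.
have inP a : (B :* a)%g \in P by rewrite mem_rcosets mulSGid ?subsetT ?inE.
exists (fun a => cast_ord oP (enum_rank_in (inP 0) (B :* a)%g)) => j.
have /rcosetsP[y _ ey] := enum_valP (cast_ord (esym oP) j).
exists y => a; rewrite -[a - y]/(a * y^-1)%g -mem_rcoset.
rewrite -(inj_eq (@cast_ord_inj _ _ (esym oP))) cast_ordK.
rewrite -(inj_eq enum_val_inj) enum_rankK_in // ey.
apply/eqP/idP => [<- | /rcoset_eqP //]; exact: rcoset_refl.
Qed.

(** As l kills V, all cosets of B q have the same sum as B q; if the sum of phi q
    over them is constant as well, the cosets of the different B q can be matched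
    in any way, so numbering them arbitrarily gives the colourings. *)
Lemma balanced_family_cosets (B : nat -> {group V}) (l n k : nat)
    (phi : nat -> V -> V) (v : nat -> V) :
    (forall q, complete_mapping (phi q)) ->
    (forall q, #|B q| = l) -> #|V| = (n * l)%N -> (forall a : V, a *+ l = 0) ->
    (forall q y, \sum_(b in B q) phi q (b + y) = v q) ->
    \sum_(q < k) \sum_(b in B q) b = 0 -> \sum_(q < k) v q = 0 ->
  exists c, @balanced_family 'I_n l k phi c.
Proof.
move=> phiP oB oV Vl sum_phi sumB sumv.
have colP q : exists c : {ffun V -> 'I_n},
    [forall j, [exists y, [forall a, (c a == j) == (a - y \in B q)]]].
  have [|c cP] := @coset_coloring (B q) n; first by rewrite oB.
  exists (finfun c); apply/forallP=> j; have [y yP] := cP j.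
  by apply/existsP; exists y; apply/forallP=> a; rewrite ffunE yP.
pose c q : V -> 'I_n := xchoose (colP q).
have cP q j : exists y, forall a, (c q a == j) = (a - y \in B q).
  have /forallP/(_ j)/existsP[y /forallP yP] := xchooseP (colP q).
  by exists y => a; exact: (eqP (yP a)).
have sum_fiber q j (F : V -> V) : exists y,
    \sum_(a | c q a == j) F a = \sum_(b in B q) F (b + y).
  have [y yP] := cP q j; exists y.
  by rewrite (reindex_inj (addIr y)); apply: eq_bigl => b; rewrite yP addrK.
exists c; split=> // [q j | j | j].
- have [y yP] := cP q j; rewrite -(oB q) -(card_imset (B q) (addIr y)).
  apply: eq_card => a; rewrite inE yP; apply/idP/imsetP => [Ba | [b Bb ->]].
    by exists (a - y); rewrite ?subrK.
  by rewrite addrK.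
- rewrite -[RHS]sumB; apply: eq_bigr => q _.
  have [y ->] := sum_fiber q j id.
  by rewrite big_split /= sumr_const oB Vl addr0.
rewrite -[RHS]sumv; apply: eq_bigr => q _.
by have [y ->] := sum_fiber q j (phi q).
Qed.

Lemma sum_setT_complete (f : V -> V) : complete_on [set: V] f -> \sum_a a = 0 :> V.
Proof.
move=> fP; transitivity (\sum_(a in [set: V]) a).
  by apply: eq_bigl => a; rewrite inE.
exact: (@sum_complete_on _ [set: V]%G f).
Qed.

Lemma sum_complete_image (f : V -> V) : complete_on [set: V] f -> \sum_a f a = 0.
Proof.
move=> fP; rewrite -[RHS](sum_setT_complete fP); have [_ f_inj _] := fP.
have finj : injective f by move=> x y; apply: f_inj; rewrite inE.
by rewrite [RHS](reindex_inj finj).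
Qed.

Lemma balanced_family_whole (f : V -> V) (k : nat) : complete_on [set: V] f ->
  @balanced_family unit #|V| k (fun _ => f) (fun _ _ => tt).
Proof.
move=> fP; split=> [_ | _ [] | [] | []].
- exact: complete_onT.
- by apply: eq_card => a; rewrite !inE.
- by apply: big1 => q _; rewrite -[RHS](sum_setT_complete fP); apply: eq_bigl.
- by apply: big1 => q _; rewrite -[RHS](sum_complete_image fP); apply: eq_bigl.
Qed.

(** Translation by t exchanges the two fibres. *)
Lemma card_half_fiber (c : V -> bool) (t : V) (j : bool) :
  (forall a, c (t + a) = ~~ c a) -> #|V| = (2 * #|[set a | c a == j]|)%N.
Proof.
move=> ct; rewrite -cardsT -(cardsID [set a | c a == j]) setTI setTD mul2n -addnn.
congr (_ + _)%N; rewrite -(card_imset [set a | c a == j] (addrI t)); apply: eq_card => a.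
rewrite !inE; apply/idP/imsetP => [cj | [b]].
  exists (- t + a); last by rewrite addNKr.
  rewrite inE; have := ct (- t + a); rewrite addNKr.
  by move: cj => /[swap] ->; case: j; case: (c _).
by rewrite inE => /eqP<- ->; rewrite ct; case: (c b).
Qed.

(** The colourings are the characters of V with kernels A and X, and their sum.
    They vanish together on K = A :&: X, and exactly one of them vanishes at any
    other point.  So the three fibres of colour 0 cover V once and K twice more,
    while those of colour 1 cover V twice and miss K.  Sums over V vanish as f is
    complete; twice the sum over K vanishes since K is stable under opposite,
    and f doubles to the same thing as the identity there. *)
Lemma balanced_family_index2 (A X : {group V}) (l : nat) (f : V -> V) :
    #|A| = l -> #|X| = l -> #|V| = (2 * l)%N -> A != X ->
    complete_on [set: V] f -> {in X, forall a, f a + f a = a + a} ->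
  exists c, @balanced_family bool l 3 (fun _ => f) c.
Proof.
move=> oA oX oV neqAX fP fX.
pose c q (a : V) : bool := match q with
  | 0 => a \notin A | 1 => a \notin X | _ => (a \notin A) (+) (a \notin X) end.
have flip (B : {group V}) s t : #|B| = l -> t \notin B -> (t + s \in B) = (s \notin B).
  move=> oB nBt; apply: (@mem_index2 _ [set: V]%G B) => //; rewrite ?subsetT ?inE //.
  by rewrite cardsT oB.
have outside (B : {group V}) : #|B| = l -> exists t, t \notin B.
  move=> oB; apply/existsP; rewrite -negb_forall; apply/negP=> /forallP BT.
  have : #|B| = #|V| by apply: eq_card => a; rewrite BT.
  have := cardG_gt0 B; rewrite oV oB; case: l {oB oA oX oV flip} => // l _ /eqP.
  by rewrite mul2n -addnn -[X in X == _]addn0 eqn_add2l.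
have [tA nAtA] := outside A oA; have [tX nXtX] := outside X oX.
have [t At nXt] : exists2 t, t \in A & t \notin X.
  apply/subsetPn; apply: contra neqAX => sAX.
  by rewrite -val_eqE eqEcard sAX oA oX leqnn.
have ct q : exists t', forall a, c q (t' + a) = ~~ c q a.
  case: q => [|[|q]] /=; [exists tA | exists tX | exists t] => a.
  - by rewrite flip.
  - by rewrite flip.
  by rewrite (flip X) // -[t + a]/(t * a)%g groupMl // addbN.
have sum_pair (F : V -> V) j : \sum_a F a = 0 ->
    \sum_(a in A :&: X) F a *+ 2 = 0 -> \sum_(q < 3) \sum_(a | c q a == j) F a = 0.
  move=> F0 FK; under eq_bigr do rewrite big_mkcond; rewrite exchange_big /=.
  move: FK; rewrite big_mkcond /= => FK; case: j.
    (* Colour 1: each point outside K is counted twice. *)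
    transitivity (\sum_a F a *+ 2 - \sum_a (if a \in A :&: X then F a *+ 2 else 0)).
      rewrite -sumrB; apply: eq_bigr => a _; rewrite !big_ord_recr big_ord0 /= in_setI.
      by case: (a \in A); case: (a \in X); rewrite /= ?add0r ?addr0 ?subr0 ?subrr.
    by rewrite FK subr0 sumrMnl F0 mul0rn.
  (* Colour 0: each point once, and the points of K twice more. *)
  transitivity (\sum_a F a + \sum_a (if a \in A :&: X then F a *+ 2 else 0)).
    rewrite -big_split; apply: eq_bigr => a _; rewrite !big_ord_recr big_ord0 /= in_setI.
    by case: (a \in A); case: (a \in X); rewrite /= ?add0r ?addr0 // mulr2n addrA.
  by rewrite FK addr0.
have sumK : \sum_(a in A :&: X) a *+ 2 = 0.
  transitivity (\sum_(a in A :&: X) a + \sum_(a in A :&: X) (- a)).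
    rewrite [X in _ + X](reindex_inj (@oppr_inj V)).
    under [X in _ + X]eq_bigr do rewrite opprK.
    under [X in _ + X]eq_bigl => a do rewrite -[- a]/(a^-1)%g groupV.
    by rewrite -big_split.
  by rewrite -big_split big1 // => a _; rewrite /= subrr.
exists c; split=> [_ | q j | j | j].
- exact: complete_onT.
- have [t' ct'] := ct q; have := card_half_fiber j ct'.
  by rewrite oV => /eqP; rewrite eqn_pmul2l // => /eqP.
- by apply: sum_pair => //; exact: (sum_setT_complete fP).
apply: sum_pair; first exact: (sum_complete_image fP).
rewrite -[RHS]sumK; apply: eq_bigr => a; rewrite in_setI => /andP[_ Xa].
by rewrite !mulr2n fX.
Qed.

End BalancedFamilies.

(** The subgroup A of [noncyclic_subgroup] serves twice: for |V| >= 4l its cosets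
    are the fibres, and for |V| = 2l it is one of the three subgroups of index 2,
    distinct from the cyclic one generated by an element of maximal order. *)
Lemma balanced_family_two_group (V : finZmodType) :
    (2.-group [set: V])%g -> ~~ cyclic [set: V] ->
  exists (J : finType) phi c, @balanced_family V J (zexp V) 3 phi c.
Proof.
move=> pV ncV; have abV : abelian [set: V] := FinRing.zmod_abelian _.
rewrite /zexp; set l := exponent _.
have Vl (a : V) : a *+ l = 0 by rewrite -[a *+ l]/(a ^+ l)%g expg_exponent ?inE.
have [n oV] : exists n, #|V| = (n * l)%N.
  by exists (#|V| %/ l)%N; rewrite divnK // -cardsT exponent_dvdn.
have [x _ ox] := exponent_witness (abelian_nil abV); rewrite -/l in ox.
have [e oe] := p_natP (pnat_dvd (exponent_dvdn _) pV); rewrite -/l in oe.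
have [e4 | ne4] := boolP (4 %| l)%N; last first.
  have l2 : l = 2%N.
    have l1 : l != 1%N.
      apply: contra ncV => /eqP l1; have : (l %| 1)%N by rewrite l1.
      by rewrite -trivg_exponent => /eqP->; exact: cyclic1.
    by move: oe ne4 l1; case: e => [|[|e]] -> //; rewrite !expnS mulnA dvdn_mulr.
  have abelV : (2.-abelem [set: V])%g by rewrite abelemE // abV -/l l2.
  have [u [_ ou nXu]] := noncyclic_involution abV pV ncV (in_setT x) (esym ox).
  have [f fP fM] := complete_abelem2 abelV ncV.
  have f_add (a b : V) : f (a + b) = f a + f b by apply: fM; rewrite inE.
  (* The three nonzero elements of the Klein group <x, u>. *)
  pose d q : V := match q with 0 => x | 1 => u | _ => x + u end.
  have od q : #[d q]%g = 2%N.
    apply: (abelem_order_p abelV); rewrite ?inE //.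
    case: q => [|[|q]] /=.
    - by rewrite -order_eq1 -ox l2.
    - by rewrite -order_eq1 ou.
    apply: contra nXu; rewrite -[x + u]/(x * u)%g -eq_invg_mul => /eqP <-.
    by rewrite groupV cycle_id.
  have sum_d q (F : V -> V) : \sum_(b in <[d q]>%g) F b = F 0 + F (d q).
    rewrite cycle2g // big_setU1 ?big_set1 // inE eq_sym -order_eq1.
    by rewrite od.
  have [|||||||c cP] := @balanced_family_cosets V (fun q => <[d q]>%G) l n 3
    (fun _ => f) (fun q => f (d q)).
  - by move=> _; exact: complete_onT.
  - by move=> q; rewrite -orderE od.
  - exact: oV.
  - exact: Vl.
  - move=> q y; rewrite sum_d add0r f_add addrCA.
    by rewrite -mulr2n -l2 Vl addr0.
  - transitivity (\sum_(q < 3) d q).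
      by apply: eq_bigr => q _; rewrite (sum_d q id) add0r.
    by rewrite !big_ord_recr big_ord0 /= add0r -mulr2n -l2 Vl.
  - rewrite !big_ord_recr big_ord0 /= add0r -!f_add.
    rewrite -mulr2n -l2 Vl.
    have := f_add 0 0; rewrite addr0 => /eqP; rewrite eq_sym -subr_eq0 addrK.
    by move/eqP.
  by exists 'I_n, (fun _ => f), c.
have [A [_ oA ncA ncQ]] := noncyclic_subgroup abV pV ncV e4.
rewrite -/l cardsT in oA ncQ.
have [le4 | gt4] := leqP (4 * l) #|V|.
  have pA : (2.-group A)%g := pgroupS (subsetT A) pV.
  have abA : abelian A := abelianS (subsetT A) abV.
  have [fA fAP] := complete_noncyclic abA pA ncA.
  have pQ : (2.-group ([set: V] / A))%g by rewrite quotient_pgroup.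
  have abQ : abelian ([set: V] / A)%g by rewrite quotient_abelian.
  have [b bP] := complete_noncyclic abQ pQ (ncQ le4).
  have [f fP fQ] := complete_extension (subsetT A) abV fAP bP.
  have nA (y : V) : y \in 'N(A)%g.
    by rewrite (subsetP (sub_abelian_norm abV (subsetT A))) ?inE.
  (* f permutes the cosets of A, and every coset of A has sum zero. *)
  have fdA y a : a \in A -> f (a + y) - f y \in A.
    move=> Aa; rewrite -[_ - _]/(f (a * y) * (f y)^-1)%g.
    apply: coset_idr; first exact: nA.
    by rewrite morphM // morphV //= !fQ ?inE // coset_kerl // mulgV.
  have [_ f_inj _] := fP.
  have A0 := sum_complete_on fAP.
  have [|||||||c cP] := @balanced_family_cosets V (fun=> A) l n 3 (fun _ => f) (fun=> 0).
  - by move=> _; exact: complete_onT.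
  - by move=> _.
  - exact: oV.
  - exact: Vl.
  - move=> _ y; transitivity (\sum_(b in A) (f (b + y) - f y) + \sum_(b in A) f y).
      by rewrite -big_split; apply: eq_bigr => b0 _; rewrite /= subrK.
    rewrite sumr_const oA Vl addr0 -[RHS]A0; apply: sum_perm_in; first exact: fdA.
    by move=> a1 a2 _ _ /addIr eqf; apply: (addIr y); apply: f_inj; rewrite ?inE.
  - by rewrite big1 // => q _; exact: A0.
  - by rewrite big1.
  by exists 'I_n, (fun _ => f), c.
have [u [_ ou nXu]] := noncyclic_involution abV pV ncV (in_setT x) (esym ox).
have oV2 : #|V| = (2 * l)%N.
  by rewrite -cardsT (card_noncyclic_small abV) // cardsT.
have x_even : ~~ odd #[x]%g by rewrite -ox -dvdn2 (dvdn_trans _ e4).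
have u2 : (u * u = 1)%g by rewrite -[RHS](expg_order u) ou.
have oT : #|[set: V]| = (2 * #[x]%g)%N by rewrite cardsT -ox.
have [f fP fX] := complete_cyclic_index2 abV (in_setT x) (in_setT u) x_even u2 nXu oT.
have neqAX : A != <[x]>%G.
  by apply: contra ncA => /eqP->; exact: cycle_cyclic.
have [||c cP] := balanced_family_index2 oA _ oV2 neqAX fP.
- by rewrite -orderE ox.
- exact: fX.
by exists bool, (fun _ => f), c.
Qed.

(** * Zero-sum transversals of the odd part *)

Lemma abelian_subgroup_card (gT : finGroupType) (G : {group gT}) (n : nat) :
    abelian G -> (n %| #|G|)%N ->
  exists2 K : {group gT}, K \subset G & #|K| = n.
Proof.
have [m] := ubnP n; elim: m => // m IHm in gT n G *; rewrite ltnS => le_nm abG dvd_n.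
have n_gt0 := dvdn_gt0 (cardG_gt0 G) dvd_n.
have [n1 | n_gt1] := leqP n 1.
  by exists 1%G; rewrite ?sub1G // cards1; apply/eqP; rewrite eqn_leq n_gt0.
pose p := pdiv n; have p_pr : prime p by exact: pdiv_prime.
have dvd_pn : (p %| n)%N by exact: pdiv_dvd.
have [x Gx ox] := Cauchy p_pr (dvdn_trans dvd_pn dvd_n).
have sXG : <[x]>%g \subset G by rewrite cycle_subG.
have nXG := sub_abelian_norm abG sXG.
have oQ : #|G / <[x]>|%g = (#|G| %/ p)%N.
  by rewrite card_quotient // -divgS // -orderE ox.
have [||| Q sQG oQn] := IHm _ (n %/ p)%N (G / <[x]>)%G.
- by rewrite (leq_trans _ le_nm) // ltn_Pdiv ?prime_gt1.
- exact: quotient_abelian.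
- by rewrite /= oQ dvdn_divRL ?divnK // (dvdn_trans dvd_pn).
have nsXG : (<[x]> <| G)%g by rewrite /normal sXG.
have [K defQ sXK sKG] := inv_quotientS nsXG sQG.
exists K => //; rewrite -(divnK dvd_pn) -oQn defQ card_quotient ?(subset_trans sKG) //.
by rewrite -divgS // -orderE ox divnK // -ox orderE cardSg.
Qed.

(** Doubling is undone by the multiple (|W| + 1) / 2. *)
Lemma halve_odd (W : finZmodType) (x : W) : odd #|W| -> x = (x + x) *+ (#|W|./2.+1).
Proof.
move=> oddW; rewrite -mulr2n -mulrnA mul2n doubleS -[in RHS]add2n.
have -> : (2 + #|W|./2.*2 = #|W|.+1)%N by rewrite -{2}[#|W|]odd_double_half oddW.
rewrite mulrSr -cardsT -[x *+ _]/(x ^+ #|[set: W]|)%g.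
by rewrite expg_cardG ?inE //; exact: esym (add0r x).
Qed.

(** The sum sigma of any transversal lies in K: the cosets are permuted by
    opposite, so sigma + sigma is a sum of terms repr C + repr (- C), all in K,
    and K has odd order.  Subtracting sigma from one member makes the sum zero. *)
Lemma zero_sum_transversal (W : finZmodType) (K : {group W}) (k : nat) :
    odd #|W| -> (0 < k)%N -> #|W| = (k * #|K|)%N ->
  exists2 s : 'I_k -> W, \sum_q s q = 0
    & forall q q', s q - s q' \in K -> q = q'.
Proof.
move=> oddW k_gt0 oW; pose P := rcosets K [set: W].
have oP : #|P| = k.
  rewrite /P -[#|_|]/(#|[set: W] : K|)%g -divgS ?subsetT //.
  by rewrite cardsT oW mulnK.
subst k; pose s0 (q : 'I_#|P|) := repr (enum_val q).
have KN i : (- i \in K) = (i \in K) by exact: (groupV K i).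
have KD i j : i \in K -> j \in K -> i + j \in K by exact: (@groupM _ K i j).
have PV C : (C^-1 \in P)%g = (C \in P).
  suff PV1 D : D \in P -> (D^-1 \in P)%g.
    by apply/idP/idP => [CP|]; [rewrite -[C]invgK PV1 | exact: PV1].
  case/rcosetsP => y _ ->; rewrite invg_rcoset -norm_rlcoset.
    by rewrite mem_rcosets mulSGid ?subsetT ?inE.
  by rewrite (subsetP (sub_abelian_norm _ (subsetT K))) ?inE ?FinRing.zmod_abelian.
pose sigma := \sum_q s0 q.
have sigmaE : sigma = \sum_(C in P) repr C by rewrite big_enum_val.
have sigmaK : sigma \in K.
  have : sigma + sigma \in K.
    rewrite {1}sigmaE sigmaE [X in _ + X](reindex_inj invg_inj) /=.
    under [X in _ + X]eq_bigl do rewrite PV.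
    rewrite -big_split /=; apply: (big_ind (fun x => x \in K)) => [||C].
    - exact: group1.
    - exact: KD.
    case/rcosetsP => y _ ->; set D := (K :* y)%g.
    have Dy : y \in D by exact: rcoset_refl.
    have : repr D \in D by exact: mem_repr Dy.
    have : (repr D^-1)^-1%g \in D.
      by rewrite -mem_invg; apply: (@mem_repr _ _ y^-1%g); rewrite mem_invg invgK.
    rewrite !mem_rcoset -[(_ * _)%g]/(- repr D^-1%g - y) -[(_ * _)%g]/(repr D - y).
    move=> K1 K2; have -> : repr D + repr D^-1%g
        = (repr D - y) - (- repr D^-1%g - y).
      by rewrite opprB opprK addrA subrK.
    by rewrite KD ?KN.
  by rewrite [sigma in X in _ -> X]halve_odd //; exact: (groupX (G := K)).
pose kappa q := if q == Ordinal k_gt0 then - sigma else 0.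
have kappaK q : kappa q \in K.
  by rewrite /kappa; case: ifP => _; rewrite ?KN //; exact: group1.
exists (fun q => s0 q + kappa q).
  by rewrite big_split /= -big_mkcond big_pred1_eq subrr.
move=> q q'; rewrite opprD addrACA => sK.
have {}sK : s0 q - s0 q' \in K.
  have Kk : kappa q - kappa q' \in K by rewrite KD ?KN.
  by rewrite -(groupMr _ Kk).
have reprK r : (K :* s0 r)%g = enum_val r.
  case/rcosetsP: (enum_valP r) => y _; rewrite /s0 => ->.
  by apply: rcoset_eqP; exact: mem_repr_rcoset.
apply: enum_val_inj; rewrite -!reprK; apply: rcoset_eqP.
by rewrite mem_rcoset.
Qed.

(** The index i of a block runs through the subgroup K of index k; b (i, q) is
    the member of block i in the coset number q. *)
Lemma zero_sum_blocks (W : finZmodType) (k : nat) :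
    odd #|W| -> (1 < k)%N -> (k %| #|W|)%N ->
  exists (T : finType) (b : T * 'I_k -> W),
    bijective b /\ forall i, \sum_q b (i, q) = 0.
Proof.
move=> oddW k_gt1 dvd_k; have odd_k := dvdn_odd dvd_k oddW.
have k_gt0 := ltnW k_gt1.
have [K _ oK] : exists2 K : {group W}, K \subset [set: W] & #|K| = (#|W| %/ k)%N.
  apply: abelian_subgroup_card; first exact: FinRing.zmod_abelian.
  by rewrite cardsT dvdn_div.
have oW : #|W| = (k * #|K|)%N by rewrite oK mulnC divnK.
have [s s0 sK] := zero_sum_transversal oddW k_gt0 oW.
(* Each g q is injective since K is odd, and their values at i add up to zero. *)
pose g q (i : W) := match q with
  | 0 | 1 => i | 2 => - (i + i) | _ => if odd q then i else - i end.
have KN i : (- i \in K) = (i \in K) by exact: (groupV K i).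
have KD i j : i \in K -> j \in K -> i + j \in K by exact: (@groupM _ K i j).
have gK q i : i \in K -> g q i \in K.
  move=> Ki; rewrite /g; case: q => [|[|[|q]]] /=; rewrite ?KN ?KD //.
  by case: ifP; rewrite ?KN.
have g_inj q : injective (g q).
  rewrite /g => i j; case: q => [|[|[|q]]] //=; last by case: ifP => // _ /oppr_inj.
  by move/oppr_inj=> eq2; rewrite (halve_odd i oddW) eq2 -(halve_odd j oddW).
pose b (z : {i | i \in K} * 'I_k) := s z.2 + g z.2 (val z.1).
exists {i | i \in K}, b; split=> [|i].
  apply: inj_card_bij.
    move=> [[i Ki] q] [[j Kj] q']; rewrite /b /= => eqb.
    have eqq : q = q'.
      apply: sK; rewrite -[s q](addrK (g q i)) eqb addrAC.
      by rewrite [_ + g q' j]addrC addrK KD ?KN ?gK.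
    by move: eqb; rewrite eqq => /addrI/g_inj eqij; congr (_, _); exact: val_inj.
  by rewrite card_prod card_sig card_ord oW mulnC.
rewrite /b big_split /= s0 add0r.
apply: (@sum_odd_pairs _ (fun q => g q (val i))) => //.
  by rewrite /g subrr.
by case=> [|[|[|q]]] //= _; rewrite /g /=; case: (odd q) => //= _; rewrite subrr.
Qed.

(** * Blocks of the product *)

Lemma zero_sum_assembly (Gamma L H : finZmodType) (T J : finType) (l k : nat)
    (f : {additive Gamma -> (L * H)%type}) (phi : nat -> L -> L) (c : nat -> L -> J)
    (b : T * 'I_k -> H) :
    odd #|H| -> bijective f -> balanced_family l k phi c ->
    bijective b -> (forall i, \sum_q b (i, q) = 0) ->
  exists (psi : Gamma -> Gamma) (P : {set {set Gamma}}),
    [/\ complete_mapping psi, partition P [set: Gamma]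
      & forall S : {set Gamma}, S \in P ->
          [/\ #|S| = (k * l)%N, \sum_(s in S) s = 0 & \sum_(s in S) psi s = 0]].
Proof.
move=> oddH [g fK gK] [phiP cP sum_c sum_phi] [e bK eK] sum_b.
pose q_of (x : Gamma) : 'I_k := (e (f x).2).2.
pose psi x := g (phi (q_of x) (f x).1, (f x).2).
pose colour x := ((e (f x).2).1, c (q_of x) (f x).1).
exists psi, (preim_partition colour [set: Gamma]).
split; last 1 first.
- move=> S /imsetP[x0 _ ->]; case Dc: (colour x0) => [i j].
  have sum_block (R : Type) (idx : R) (op : Monoid.com_law idx) (F0 : Gamma -> R) :
      \big[op/idx]_(x in [set y in [set: Gamma] | (i, j) == colour y]) F0 x
      = \big[op/idx]_(q < k) \big[op/idx]_(a | c q a == j) F0 (g (a, b (i, q))).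
    pose h (z : 'I_k * L) := g (z.2, b (i, z.1)).
    rewrite pair_big_dep (reindex_onto h (fun x => (q_of x, (f x).1))) /=.
      apply: eq_bigl => -[q a]; rewrite !inE /h /colour /q_of !gK /= bK /= !eqxx.
      by rewrite andbT xpair_eqE eqxx eq_sym.
    move=> x; rewrite inE /h /q_of /= => /andP[_ /eqP[-> _]].
    by rewrite -[in RHS](fK x) -surjective_pairing eK -surjective_pairing.
  (* Both sums are instances: F is the identity or psi, G its effect on L. *)
  have block0 (F : Gamma -> Gamma) (G : nat -> L -> L) :
      (forall (q : 'I_k) a, F (g (a, b (i, q))) = g (G q a, b (i, q))) ->
      \sum_(q < k) \sum_(a | c q a == j) G q a = 0 ->
    \sum_(x in [set y in [set: Gamma] | (i, j) == colour y]) F x = 0.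
    move=> FG G0; rewrite sum_block; apply: (can_inj fK); rewrite raddf0 raddf_sum.
    transitivity (\sum_(q < k) \sum_(a | c q a == j) (G q a, b (i, q))).
      apply: eq_bigr => q _; rewrite raddf_sum.
      by apply: eq_bigr => a _; rewrite FG gK.
    rewrite [LHS]surjective_pairing; congr (_, _); rewrite raddf_sum.
      by rewrite -[RHS]G0; apply: eq_bigr => q _; rewrite raddf_sum.
    transitivity (\sum_(q < k) b (i, q) *+ l); last by rewrite sumrMnl sum_b mul0rn.
    by apply: eq_bigr => q _; rewrite raddf_sum /= -(cP q j) sumr_const cardsE.
  split.
  + rewrite -sum1_card sum_block.
    under eq_bigr do rewrite sum1_card -cardsE cP.
    by rewrite sum_nat_const card_ord.
  + by apply: (block0 id (fun _ a => a)) => //; rewrite sum_c.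
  apply: (block0 psi phi) => [q a|]; last by rewrite sum_phi.
  by rewrite /psi /q_of gK /= bK.
- have f_inj := can_inj fK; have g_inj := can_inj gK.
  have eq_pair (x y : Gamma) : (f x).1 = (f y).1 -> (f x).2 = (f y).2 -> x = y.
    move=> e1 e2; apply: f_inj.
    by rewrite [LHS]surjective_pairing e1 e2 -surjective_pairing.
  split; apply: injF_bij => x y.
    move/g_inj => [e1 e2]; apply: eq_pair => //; move: e1; rewrite /q_of e2.
    by have [/bij_inj phi_inj _] := phiP (e (f y).2).2 => /phi_inj.
  move/(congr1 f); rewrite !raddfD /= /psi !gK => -[e1 e2].
  have {}e2 : (f x).2 = (f y).2.
    by rewrite (halve_odd (f x).2 oddH) e2 -(halve_odd _ oddH).
  apply: eq_pair => //; move: e1; rewrite /q_of e2.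
  by have [_ /bij_inj phi_inj] := phiP (e (f y).2).2 => /phi_inj.
exact: preim_partitionP.
Qed.

Lemma class_G_dichotomy (Gamma L H : finZmodType) (eta : nat) :
    zmod_isomorphic Gamma (L * H)%type -> class_G Gamma -> odd #|H| ->
    #|L| = (2 ^ eta)%N ->
  #|L| = 1%N /\ odd #|Gamma| \/ ~~ cyclic [set: L].
Proof.
move=> [f f_bij] /orP[oddG | inv2] oddH oL.
  left; split=> //; move: oddG; rewrite (bij_eq_card f_bij) card_prod oddM => /andP[].
  by rewrite oL; case: eta {oL} => // eta; rewrite expnS oddM.
right; apply/negP=> cycL; have /card_gt1P[x [y [xI yI /negP neq_xy]]] := inv2.
have inv_L z : z \in involutions Gamma -> (f z).2 = 0 /\ #[(f z).1]%g = 2%N.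
  rewrite inE => /eqP oz; have z2 : z + z = 0.
    by rewrite -[RHS](expg_order z) oz.
  have /eqP := congr1 f z2; rewrite raddfD raddf0 xpair_eqE => /andP[/eqP f1 /eqP f2].
  have {}f2 : (f z).2 = 0 by rewrite (halve_odd (f z).2 oddH) f2 mul0rn.
  split=> //; apply: nt_prime_order => //; apply/eqP=> f10.
  suff z0 : z = 0 by move: oz; rewrite z0 order1.
  apply: (bij_inj f_bij); rewrite raddf0 [LHS]surjective_pairing f2.
  by congr (_, _).
have [fx2 ox] := inv_L x xI; have [fy2 oy] := inv_L y yI.
have eq_cyc : <[(f x).1]>%G :==: <[(f y).1]>%G.
  by rewrite (eq_subG_cyclic cycL) ?subsetT //= -!orderE ox oy.
have : (f x).1 \in <[(f y).1]>%g by rewrite -(eqP eq_cyc) cycle_id.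
rewrite cycle2g // !inE -order_eq1 ox /= => /eqP fx1.
case: neq_xy; apply/eqP/(bij_inj f_bij).
by rewrite [LHS]surjective_pairing fx1 fx2 -fy2 -surjective_pairing.
Qed.

(** From |L| * |H| = 2 exp(Gamma), which divides 2 exp(L) exp(H), itself a divisor
    of 2 exp(L) |H|. *)
Lemma exponent_half_card (Gamma L H : finZmodType) :
    zmod_isomorphic Gamma (L * H)%type -> (2 * zexp Gamma)%N = #|Gamma| ->
  (#|L| %| 2 * zexp L)%N.
Proof.
move=> [f f_bij] eG.
have exp_dvd : (zexp Gamma %| zexp L * zexp H)%N.
  apply/exponentP=> x _; apply: (bij_inj f_bij).
  rewrite -[(x ^+ _)%g]/(x *+ (zexp L * zexp H)) raddfMn raddf0.
  rewrite [LHS]surjective_pairing; congr (_, _).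
    rewrite raddfMn mulrnA.
    by rewrite -[_ *+ zexp L]/((f x).1 ^+ _)%g expg_exponent ?inE // mul0rn.
  rewrite raddfMn mulnC mulrnA.
  by rewrite -[_ *+ zexp H]/((f x).2 ^+ _)%g expg_exponent ?inE // mul0rn.
have H_gt0 : (0 < #|H|)%N by rewrite -cardsT cardG_gt0.
rewrite -(dvdn_pmul2r H_gt0) -card_prod -(bij_eq_card f_bij) -eG -mulnA.
rewrite dvdn_pmul2l // (dvdn_trans exp_dvd) // dvdn_mul //.
by rewrite -cardsT exponent_dvdn.
Qed.

Theorem theorem3p4 (Gamma L H : finZmodType) (eta k : nat)
    (hiso : zmod_isomorphic Gamma (L * H)%type)
    (hG : class_G Gamma)
    (hH : odd #|H|)
    (hL : #|L| = (2 ^ eta)%N)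
    (hk1 : (1 < k)%N)
    (hk : (k %| #|H|)%N) :
  let m := (k * block_factor Gamma L)%N in
  exists (phi : Gamma -> Gamma) (P : {set {set Gamma}}),
    [/\ complete_mapping phi,
        partition P [set: Gamma]
      & forall S : {set Gamma}, S \in P ->
          [/\ #|S| = m, \sum_(s in S) s = 0 & \sum_(s in S) phi s = 0]].
Proof.
have odd_k := dvdn_odd hk hH.
have [T [b [b_bij sum_b]]] := zero_sum_blocks hH hk1 hk.
suff [J [phi [c famL]]] : exists (J : finType) phi c,
    @balanced_family L J (block_factor Gamma L) k phi c.
  by have [f f_bij] := hiso; exact: zero_sum_assembly hH f_bij famL b_bij sum_b.
have whole f : complete_on [set: L] f -> block_factor Gamma L = #|L| ->
    exists (J : finType) phi c, @balanced_family L J (block_factor Gamma L) k phi c.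
  move=> fP ->; exists unit, (fun _ => f), (fun _ _ => tt).
  exact: balanced_family_whole.
have [[L1 oddG] | ncL] := class_G_dichotomy hiso hG hH hL.
  have eqL (x y : L) : x = y.
    by have/card_le1_eqP := eq_leq L1; apply.
  apply: (whole id); first by split=> // x y _ _ _; exact: eqL.
  rewrite /block_factor; case: eqP => [eG|_]; first by rewrite -eG oddM in oddG.
  have := exponent_dvdn [set: L]; rewrite cardsT L1 => /dvdn_leq le1.
  by apply/eqP; rewrite eqn_leq le1 //= exponent_gt0.
have pL : (2.-group [set: L])%g by rewrite /pgroup cardsT hL pnatX pnat_id.
have abL : abelian [set: L] := FinRing.zmod_abelian _.
rewrite /block_factor in whole *; case: eqP whole => [eG | _] whole; last first.
  have [J [phi [c famL]]] := balanced_family_two_group pL ncL.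
  by exists J; exact: balanced_family_odd famL.
have [f fP] := complete_noncyclic abL pL ncL; apply: (whole f) => //.
apply/eqP; rewrite eqn_dvd (exponent_half_card hiso eG) andbT -cardsT.
exact: dvdn_exponent_noncyclic.
Qed.
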